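(* Let $\mathcal{I}$ be a system of linear inequalities with integer coefficients in variables $x_1,\dots,x_n$ that has no $0$-$1$ solution. Suppose that for some partition of the $n$ variables into two parts, the Karchmer–Wigderson game for $\mathcal{I}$ requires $t$ bits of randomized communication. Then every tree-like Cutting Planes proof of the unsatisfiability of $\mathcal{I}$, even one whose coefficients are of unbounded size, has size $2^{\Omega(t/\log n)}$ (with an absolute constant in the $\Omega(\cdot)$).
   Context: A Cutting Planes (CP) proof that $\mathcal{I}$ has no $0$-$1$ solution is a sequence of linear inequalities with integer coefficients, arranged as a directed acyclic graph, where each line is either an axiom (an inequality of $\mathcal{I}$) or is derived from earlier lines by one of the rules: (addition) from $\vec a_1\cdot\vec x\le c_1$ and $\vec a_2\cdot \vec x\le c_2$ derive $(\vec a_1+\vec a_2)\cdot\vec x\le c_1+c_2$; (scalar multiplication) from $\vec a\cdot\vec x\le c$ derive $d(\vec a\cdot \vec x)\le dc$ for a positive integer $d$ (and with the inequality reversed for a negative integer $d$); (rounded division) from $c(\vec a\cdot\vec x)\le d$ with $c$ a positive integer derive $\vec a\cdot\vec x\le \lfloor d/c\rfloor$; and the last line is an arithmetically false statement such as $1\le 0$. A tree-like CP proof is a CP proof whose underlying graph is a tree (each derived line is used at most once); its size is the number of lines. No bound is imposed on the magnitude of the coefficients. The Karchmer–Wigderson (KW) game for $\mathcal{I}$ with respect to a partition $P_1,P_2$ of the variables is the communication problem in which, for an assignment $\alpha\in\{0,1\}^n$, Alice receives the restriction of $\alpha$ to $P_1$, Bob receives the restriction of $\alpha$ to $P_2$,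 and they must output an inequality of $\mathcal{I}$ falsified by $\alpha$. ''Requires $t$ bits of randomized communication'' means every public-coin randomized protocol that solves the game with bounded error (correct with high probability on every input) communicates at least $t$ bits. *)

(* Defs.v *)
From mathcomp Require Import all_boot all_order all_algebra.
Set Implicit Arguments. Unset Strict Implicit. Unset Printing Implicit Defensive.
Import Order.TTheory GRing.Theory Num.Theory.
Local Open Scope ring_scope.

(** A linear inequality  a . x <= b  over n variables, integer coefficients. *)
Definition ineq (n : nat) : Type := ({ffun 'I_n -> int} * int)%type.

Definition lhs_val (n : nat) (l : ineq n) (x : {ffun 'I_n -> bool}) : int :=
  \sum_(i < n) l.1 i * (nat_of_bool (x i))%:Z.

Definition satisfies (n : nat) (x : {ffun 'I_n -> bool}) (l : ineq n) : bool :=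
  lhs_val l x <= l.2.

Definition unsat01 (n : nat) (I : seq (ineq n)) : Prop :=
  ~ exists x : {ffun 'I_n -> bool}, all (satisfies x) I.

Inductive cp (n : nat) : Type :=
| CPAx of ineq n
| CPAdd of cp n & cp n
| CPMul of int & cp n
| CPDiv of int & cp n.

Fixpoint cp_concl (n : nat) (p : cp n) : ineq n :=
  match p with
  | CPAx l => l
  | CPAdd p q =>
      let l1 := cp_concl p in let l2 := cp_concl q in
      ([ffun i => l1.1 i + l2.1 i], l1.2 + l2.2)
  | CPMul d p =>
      let l := cp_concl p in ([ffun i => d * l.1 i], d * l.2)
  | CPDiv c p =>
      let l := cp_concl p in ([ffun i => (l.1 i %/ c)%Z], (l.2 %/ c)%Z)
  end.

Fixpoint cp_valid (n : nat) (I : seq (ineq n)) (p : cp n) : bool :=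
  match p with
  | CPAx l => l \in I
  | CPAdd p q => cp_valid I p && cp_valid I q
  | CPMul d p => (0 < d) && cp_valid I p
  | CPDiv c p =>
      [&& 0 < c, [forall i, (c %| (cp_concl p).1 i)%Z] & cp_valid I p]
  end.

Fixpoint cp_size (n : nat) (p : cp n) : nat :=
  match p with
  | CPAx _ => 1
  | CPAdd p q => (cp_size p + cp_size q).+1
  | CPMul _ p => (cp_size p).+1
  | CPDiv _ p => (cp_size p).+1
  end.

Definition arith_false (n : nat) (l : ineq n) : bool :=
  [forall i, l.1 i == 0] && (l.2 < 0).

Definition cp_refutation (n : nat) (I : seq (ineq n)) (p : cp n) : bool :=
  cp_valid I p && arith_false (cp_concl p).

Inductive proto (A B O : Type) : Type :=
| PLeaf of O
| PAlice of (A -> bool) & proto A B O & proto A B O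
| PBob of (B -> bool) & proto A B O & proto A B O.

Fixpoint peval (A B O : Type) (a : A) (b : B) (p : proto A B O) : O :=
  match p with
  | PLeaf o => o
  | PAlice f p0 p1 => if f a then peval a b p1 else peval a b p0
  | PBob g p0 p1 => if g b then peval a b p1 else peval a b p0
  end.

Fixpoint pdepth (A B O : Type) (p : proto A B O) : nat :=
  match p with
  | PLeaf _ => 0
  | PAlice _ p0 p1 => (maxn (pdepth p0) (pdepth p1)).+1
  | PBob _ p0 p1 => (maxn (pdepth p0) (pdepth p1)).+1
  end.

(** restriction of an assignment to a set of variables (other coordinates
    are erased to false, so a function of the result only sees x on S) *)
Definition restr (n : nat) (S : {set 'I_n}) (x : {ffun 'I_n -> bool})
  : {ffun 'I_n -> bool} := [ffun i => (i \in S) && x i].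

Definition assign (n : nat) := {ffun 'I_n -> bool}.

Definition kw_run (n : nat) (S : {set 'I_n})
  (p : proto (assign n) (assign n) (ineq n)) (x : assign n) : ineq n :=
  peval (restr S x) (restr (~: S) x) p.

Definition kw_correct (n : nat) (I : seq (ineq n)) (x : assign n) (l : ineq n)
  : bool := (l \in I) && ~~ satisfies x l.

(** Every public-coin randomized protocol (a uniformly random public string
    r from a nonempty finite set T, and a deterministic protocol P r for each
    r) solving the KW game with error probability <= 1/3 on every input
    communicates at least t bits (for some value of the random string). *)
Definition kw_requires (n : nat) (I : seq (ineq n)) (S : {set 'I_n}) (t : nat)
  : Prop :=
  forall (T : finType) (P : T -> proto (assign n) (assign n) (ineq n)),
    (0 < #|T|)%N ->
    (forall x : assign n,
        (3 * #|[set r | ~~ kw_correct I x (kw_run S (P r) x)]| <= #|T|)%N) ->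
    exists r : T, (t <= pdepth (P r))%N.

(* Main.v *)
Require Import Defs.
From mathcomp Require Import all_boot all_order all_algebra.
From mathcomp Require Import zify.
Set Implicit Arguments. Unset Strict Implicit. Unset Printing Implicit Defensive.
Import Order.TTheory GRing.Theory Num.Theory.

(* Let [s] be the size of the proof.  The final line is false, so the players can
   look for a false axiom by repeatedly evaluating the root [v] of a subtree with
   between one and two thirds of the leaves: if [v] is false they keep only that
   subtree, otherwise they cut it off.  This takes O(log s) rounds.

   Evaluating a line means comparing a number known to Alice with one known to
   Bob.  Only the ranks of these numbers matter, hence (n + 2)-bit integers
   suffice whatever the coefficients, and the first differing prefix of two such
   integers is found with O(log n + log (1 / e)) bits and error [e] by a binary
   search with backtracking, using hashed equality tests of constant error.

   The union bound over the rounds asks for [e] of order 1 / log s, which is fine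
   if s <= 2 ^ n; otherwise Alice can afford to send her whole input. *)

(** * Composition of protocols and a hashed equality test *)

Section Protocols.
Variables A B : Type.

Fixpoint pbind (O O' : Type) (p : proto A B O) (k : O -> proto A B O') :
    proto A B O' :=
  match p with
  | PLeaf o => k o
  | PAlice f p0 p1 => PAlice f (pbind p0 k) (pbind p1 k)
  | PBob g p0 p1 => PBob g (pbind p0 k) (pbind p1 k)
  end.

Lemma peval_bind (O O' : Type) a b (p : proto A B O) (k : O -> proto A B O') :
  peval a b (pbind p k) = peval a b (k (peval a b p)).
Proof.
by elim: p => //= f p0 IH0 p1 IH1; rewrite IH0 IH1; case: (f _).
Qed.

Lemma pdepth_bind (O O' : Type) (p : proto A B O) (k : O -> proto A B O') c d :
  pdepth p <= c -> (forall o, pdepth (k o) <= d) -> pdepth (pbind p k) <= c + d.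
Proof.
move=> + kd; elim: p c => [o c _|f p0 IH0 p1 IH1|f p0 IH0 p1 IH1] /=.
- exact: leq_trans (kd o) (leq_addl _ _).
- by case=> // c; rewrite addSn !ltnS !geq_max => /andP[/IH0 -> /IH1 ->].
- by case=> // c; rewrite addSn !ltnS !geq_max => /andP[/IH0 -> /IH1 ->].
Qed.

(** Binary digits are sent from the most significant down, so the value received is rebuilt by
    doubling. *)
Fixpoint psend k (f : A -> nat) : proto A B nat :=
  if k is k'.+1 then
    pbind (psend k' (fun a => (f a)./2))
      (fun v => PAlice (fun a => odd (f a)) (PLeaf _ _ v.*2) (PLeaf _ _ v.*2.+1))
  else PLeaf _ _ 0.

Lemma peval_send k f a b : f a < 2 ^ k -> peval a b (psend k f) = f a.
Proof.
elim: k f => [|k IH] f; first by rewrite ltnS leqn0 => /eqP.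
move=> fk /=; rewrite peval_bind IH /=; last by rewrite expnS in fk; lia.
by have := odd_double_half (f a); case: (odd _) => /=; lia.
Qed.

Lemma pdepth_send k f : pdepth (psend k f) <= k.
Proof.
elim: k f => //= k IH f; rewrite -addn1.
by apply: pdepth_bind.
Qed.

(** Four bits from Alice and one from Bob. The answer [true] certifies that the numbers differ; only
    [false] may be wrong, through a collision. *)
Definition hash_test (h : nat -> 'I_16) (fa : A -> nat) (fb : B -> nat) :
    proto A B bool :=
  pbind (psend 4 (fun a => h (fa a)))
    (fun v => PBob (fun b => v != h (fb b)) (PLeaf _ _ false) (PLeaf _ _ true)).

Lemma peval_hash_test h fa fb a b :
  peval a b (hash_test h fa fb) = (h (fa a) != h (fb b)).
Proof. by rewrite /hash_test peval_bind peval_send //=; case: ifP. Qed.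

End Protocols.

(** The sample space of [k] independent draws from [W]; all probabilities below are ratios of
    cardinals. *)
Fixpoint rnd (W : finType) k : finType :=
  if k is k'.+1 then (W * rnd W k')%type else unit.

Lemma card_rndS (W : finType) k : #|rnd W k.+1| = #|W| * #|rnd W k|.
Proof. exact: card_prod. Qed.

Lemma card_rnd_gt0 (W : finType) k : 0 < #|W| -> 0 < #|rnd W k|.
Proof.
by move=> W0; elim: k => [|k IH]; rewrite ?card_unit // card_rndS muln_gt0 W0.
Qed.

(** * Binary search with backtracking under one-sided noise *)

Section Search.

(* [s] stacks the left ends found so far and [hi] is the right end.  A positive
   answer of [Q] is always right, so [hi] is certain and only left ends may have
   to be given up. *)
Definition search_step (Q : nat -> bool) (st : seq nat * nat) : seq nat * nat :=
  let: (s, hi) := st in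
  let lo := head 0 s in
  let mid := (lo + hi)./2 in
  if Q lo then (behead s, lo)
  else if hi <= lo.+1 then st
  else if Q mid then (s, mid) else (mid :: s, hi).

Variables (H : finType) (Q : H -> nat -> bool) (m d : nat).
Hypothesis d_gt0 : 0 < d.
Hypothesis Q_sound : forall h j, Q h j -> d <= j.
Hypothesis Q_error :
  forall j, d <= j <= m -> 16 * #|[set h | ~~ Q h j]| <= #|H|.

(* A wrong left end on the stack costs a factor 4; the interval that remains once
   all of them are removed counts with the cube of its length.  With this choice
   the expectation of [potential - 1] at least halves at every step. *)
Fixpoint potential (s : seq nat) (hi : nat) : nat :=
  if s is lo :: s' then
    if d <= lo then 4 * potential s' lo else (hi - lo) ^ 3
  else hi ^ 3.

(** The appended [0] is the initial left end, which [head 0] returns on an empty stack; it is always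
    correct since [0 < d]. *)
Definition search_inv (st : seq nat * nat) :=
  path gtn st.2 (rcons st.1 0) && (d <= st.2 <= m).

Definition search_done (st : seq nat * nat) :=
  (head 0 st.1 < d) && (st.2 == (head 0 st.1).+1).

Lemma potential_good s hi :
  head 0 s < d -> potential s hi = (hi - head 0 s) ^ 3.
Proof. by case: s => [|lo s] /=; rewrite ?subn0 // ltnNge => /negbTE ->. Qed.

Lemma search_inv_lo s hi : search_inv (s, hi) -> head 0 s < hi.
Proof. by case: s => [|lo s] /andP[/= /andP[]]. Qed.

Lemma search_inv_step h st : search_inv st -> search_inv (search_step (Q h) st).
Proof.
case: st => s hi inv; have lohi := search_inv_lo inv; move: inv.
rewrite /search_step /search_inv /=.
case: ifP => [Qlo|_].
  have := Q_sound Qlo; case: s lohi {Qlo} => [|lo s] /=.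
    by move=> _ /(leq_trans d_gt0).
  by move=> lohi -> /andP[/andP[_ ->]] /andP[_ him] /=; lia.
case: (leqP hi (head 0 s).+1) => [_|gap] //.
have midlo : head 0 s < (head 0 s + hi)./2 by lia.
have midhi : (head 0 s + hi)./2 < hi by lia.
case: ifP => [Qmid|_] /andP[ph dh] /=.
  have -> : d <= (head 0 s + hi)./2 by exact: Q_sound Qmid.
  rewrite andTb; apply/andP; split; last by lia.
  case: s ph midlo {lohi gap midhi Qmid} => [|lo s] /=; first by move=> _ ->.
  by move=> /andP[_ ->] ->.
rewrite midhi dh andbT /=.
case: s ph midlo {lohi gap midhi} => [|lo s] /=; first by move=> _ ->.
by move=> /andP[_ ->] ->.
Qed.

Lemma potential_gt0 s hi : search_inv (s, hi) -> 0 < potential s hi.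
Proof.
elim: s hi => [|lo s IH] hi /=; first by rewrite expn_gt0 /search_inv /=; lia.
move=> /andP[/= /andP[lohi p] dm]; case: (leqP d lo) => [dlo|lod].
  rewrite muln_gt0 /=; apply: IH; rewrite /search_inv /= p dlo /=.
  by apply: leq_trans (ltnW lohi) _; case/andP: dm.
by rewrite expn_gt0; lia.
Qed.

(** Needed for Markov's inequality: an unfinished search has [potential - 1] at least 1. *)
Lemma potential_gt1 s hi :
  search_inv (s, hi) -> ~~ search_done (s, hi) -> 1 < potential s hi.
Proof.
move=> inv; have lohi := search_inv_lo inv; rewrite /search_done /=.
case: (ltnP (head 0 s) d) => [lod|dlo] /=.
  move=> ne; rewrite potential_good // (@leq_trans (2 ^ 3)) // leq_exp2r //; lia.
move=> _; have := potential_gt0 inv.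
by case: s dlo {inv lohi} => [|lo s] /=; [lia|move=> -> ; lia].
Qed.

Lemma sum_if_le (P : pred H) a b c :
  (forall h, c h <= a + ~~ P h * b) ->
  \sum_h c h <= #|H| * a + #|[set h | ~~ P h]| * b.
Proof.
move=> le; apply: leq_trans (leq_sum _ (fun h _ => le h)) _.
rewrite big_split /= sum_nat_const leq_add2l -big_distrl /= leq_mul2r.
rewrite -sum1dep_card [X in _ <= X]big_mkcond /=.
by apply/orP; right; apply: leq_sum => h _; case: (P h).
Qed.

Lemma potential_step st : search_inv st ->
  2 * \sum_h potential (search_step (Q h) st).1 (search_step (Q h) st).2 <=
  #|H| * (potential st.1 st.2).+1.
Proof.
case: st => s hi inv; have lohi := search_inv_lo inv; rewrite /search_step.
case: (ltnP (head 0 s) d) => [lod|dlo].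
  have nQ h : Q h (head 0 s) = false.
    by apply/negP => /Q_sound; rewrite leqNgt lod.
  under eq_bigr do rewrite nQ.
  case: (leqP hi (head 0 s).+1) => [hilo|gap] /=.
    have -> : potential s hi = 1.
      by rewrite potential_good // (_ : hi - _ = 1) //; lia.
    by rewrite sum_nat_const mulnC muln1.
  set mid := (head 0 s + hi)./2; set g := hi - head 0 s.
  have midlo : head 0 s < mid by rewrite /mid; lia.
  rewrite [potential s hi]potential_good // -/g.
  case: (leqP d mid) => [dmid|midd]; last first.
    (* Here [mid] is a correct left end and the test cannot answer positively. The new length is at
       most [(g + 1) / 2], and [(g + 1) ^ 3 <= 4 * (g ^ 3 + 1)]. *)
    under eq_bigr => h _.
      have /negbTE -> : ~~ Q h mid by apply/negP => /Q_sound; rewrite leqNgt midd.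
      rewrite /= leqNgt midd /=; over.
    rewrite sum_nat_const mulnCA leq_mul2l; apply/orP; right.
    have : 2 * (hi - mid) <= g.+1 by rewrite /mid /g; lia.
    move: (hi - mid) => k; rewrite -(@leq_exp2r _ _ 3) // expnMn => le.
    have : g.+1 ^ 3 <= 4 * (g ^ 3).+1.
      by case: (g) => // e; rewrite !expnS expn0 !muln1; nia.
    by move: le; rewrite -[2 ^ 3]/8; lia.
  (* A positive answer leaves [k ^ 3]; a negative one, of probability at most 1/16, stacks a wrong
     left end and leaves [4 * k ^ 3]. Since [k] is at most half of [g], the mean is small enough. *)
  have err : 16 * #|[set h | ~~ Q h mid]| <= #|H|.
    by apply: Q_error; case/andP: inv => _ /=; rewrite /mid; lia.
  set k := mid - head 0 s.
  apply: (@leq_trans (2 * (#|H| * k ^ 3 + #|[set h | ~~ Q h mid]| * (3 * k ^ 3)))).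
    rewrite leq_mul2l /=; apply: sum_if_le => h; case: (Q h mid) => /=.
      by rewrite potential_good // leq_addr.
    by rewrite dmid potential_good // -/k mul1n; move: (k ^ 3) => k3; lia.
  have : 8 * k ^ 3 <= g ^ 3.
    rewrite -[8]/(2 ^ 3) -expnMn leq_exp2r // /k /mid /g; lia.
  move: err; move: #|[set h | _]| #|H| (k ^ 3) (g ^ 3) => u a k3 g3 err le.
  have : 16 * u * k3 <= a * k3 by rewrite leq_mul2r err orbT.
  have : a * (8 * k3) <= a * g3 by rewrite leq_mul2l le orbT.
  nia.
(* The top left end is wrong and the potential is [4 * v]. Popping it leaves [v]; missing it, with
   probability at most 1/16, leaves at most [16 * v]. The mean is thus at most [2 * v]. *)
case: s inv dlo lohi => [|lo s] inv /= dlo lohi; first by lia.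
have err : 16 * #|[set h | ~~ Q h lo]| <= #|H|.
  by apply: Q_error; case/andP: inv => _ /=; lia.
rewrite dlo; set v := potential s lo.
apply: (@leq_trans (2 * (#|H| * v + #|[set h | ~~ Q h lo]| * (16 * v)))).
  rewrite leq_mul2l /=; apply: sum_if_le => h; case: (Q h lo) => /=; first by lia.
  have dmid : lo.+1 < hi -> d <= (lo + hi)./2 by lia.
  case: (leqP hi lo.+1) => [_|/dmid dm] /=; first by rewrite dlo -/v; lia.
  by case: (Q h _) => /=; rewrite ?dm dlo -/v; lia.
move: err; move: #|[set h | _]| #|H| => u a err.
have : 16 * u * v <= a * v by rewrite leq_mul2r err orbT.
nia.
Qed.

Fixpoint search_run k (r : rnd H k) (st : seq nat * nat) : seq nat * nat :=
  match k as k0 return rnd H k0 -> seq nat * nat with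
  | 0 => fun _ => st
  | k'.+1 => fun r => search_run r.2 (search_step (Q r.1) st)
  end r.

Lemma search_inv_run k (r : rnd H k) st :
  search_inv st -> search_inv (search_run r st).
Proof.
by elim: k r st => //= k IH [h r] st inv /=; apply/IH/search_inv_step.
Qed.

(** Iterating [potential_step]: the mean of [potential - 1] shrinks by [2 ^ k], written without
    subtraction. *)
Lemma potential_run k st : search_inv st ->
  2 ^ k * (\sum_(r : rnd H k)
    potential (search_run r st).1 (search_run r st).2) + #|rnd H k| <=
  #|rnd H k| * (potential st.1 st.2 + 2 ^ k).
Proof.
elim: k st => [|k IH] st inv.
  by rewrite /= sum_nat_const card_unit; lia.
rewrite -(pair_big predT predT (fun h r => potential
   (search_run r (search_step (Q h) st)).1 (search_run r (search_step (Q h) st)).2)) /=.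
have step := potential_step inv.
have : \sum_(h : H) (2 ^ k * (\sum_(r : rnd H k)
    potential (search_run r (search_step (Q h) st)).1
              (search_run r (search_step (Q h) st)).2) + #|rnd H k|) <=
  \sum_(h : H) (#|rnd H k| * (potential (search_step (Q h) st).1
     (search_step (Q h) st).2 + 2 ^ k)).
  by apply: leq_sum => h _; apply/IH/search_inv_step.
rewrite big_split /= -!big_distrr /= big_split /= !sum_nat_const card_rndS.
move: step; set X := \sum_h _; set Y := \sum_h \sum_r _.
rewrite expnS; move: (2 ^ k) #|H| #|rnd H k| (potential _ _) => c a b v.
move=> step; have : 2 * b * X <= b * (a * v.+1) by nia.
nia.
Qed.

Lemma search_run_error k st : search_inv st ->
  2 ^ k * #|[set r : rnd H k | ~~ search_done (search_run r st)]| <=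
  #|rnd H k| * (potential st.1 st.2).-1.
Proof.
move=> inv; have := potential_run k inv.
have p0 : 0 < potential st.1 st.2 by apply: potential_gt0; case: st inv.
suff : #|rnd H k| + #|[set r : rnd H k | ~~ search_done (search_run r st)]| <=
  \sum_(r : rnd H k) potential (search_run r st).1 (search_run r st).2.
  move: (2 ^ k) #|[set r | _]| (\sum_r _) #|rnd H k| => c x y a le1 le2.
  have : c * (a + x) <= c * y by rewrite leq_mul2l le1 orbT.
  nia.
have {1}-> : #|rnd H k| = \sum_(r : rnd H k) 1 by rewrite sum1_card.
rewrite -sum1dep_card [X in _ + X]big_mkcond -big_split /=.
apply: leq_sum => r _.
have := search_inv_run r inv; case: (search_run r st) => s hi inv'.
case: ifP => [nd|_]; first exact: potential_gt1.
by rewrite addn0 potential_gt0.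
Qed.

End Search.

(** Overwriting [h b] by an arbitrary value is injective on pairs of a value and a colliding [h],
    because [h b] can be recovered from [h a]. *)
Lemma card_collision (X : finType) K (a b : X) : a != b ->
  K * #|[set h : {ffun X -> 'I_K} | h a == h b]| <= #|{ffun X -> 'I_K}|.
Proof.
move=> ab; set S := [set h | _].
pose f (y : 'I_K * {ffun X -> 'I_K}) := [ffun x => if x == b then y.1 else y.2 x].
have f_inj : {in setX setT S &, injective f}.
  move=> [c h] [c' h']; rewrite !inE /= => /eqP hS /eqP hS' /ffunP eqf.
  have eqh x : x != b -> h x = h' x.
    by move=> /negbTE xb; have := eqf x; rewrite !ffunE xb.
  have -> : c = c' by have := eqf b; rewrite !ffunE eqxx.
  congr pair; apply/ffunP => x; case: (eqVneq x b) => [->|]; last exact: eqh.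
  by rewrite -hS -hS' eqh.
by rewrite -{1}[K]card_ord -cardsT -cardsX -(card_in_imset f_inj) max_card.
Qed.

(** * Randomized comparison of two [m]-bit integers *)

Section LessThan.
Variables (A B : Type) (m : nat).

(** The domain has a successor as its size so that [inord] applies. *)
Definition hash_space := {ffun 'I_(2 ^ m).+1 -> 'I_16}.

(** The [j] leading bits of an [m]-bit number, for [j <= m]. *)
Definition prefix (j v : nat) := v %/ 2 ^ (m - j).

Lemma prefix_coarsen i j v : i <= j <= m -> prefix i v = prefix j v %/ 2 ^ (j - i).
Proof.
by move=> /andP[ij jm]; rewrite /prefix -divnMA -expnD; congr (_ %/ 2 ^ _); lia.
Qed.

Definition differ (u w : nat) (h : hash_space) (j : nat) :=
  h (inord (prefix j u)) != h (inord (prefix j w)).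

(** The witness is the least length at which the prefixes differ. Longer prefixes differ too, and
    those of length [d] differ only in their last bit, which therefore decides the order. *)
Lemma first_difference u w : u < 2 ^ m -> w < 2 ^ m -> u != w ->
  exists d, [/\ 0 < d <= m,
    forall h j, differ u w h j -> d <= j,
    forall j, d <= j <= m ->
      16 * #|[set h | ~~ differ u w h j]| <= #|{: hash_space}| &
    ~~ odd (prefix d u) = (u < w)].
Proof.
move=> um wm uw.
have ex : exists j, prefix j u != prefix j w.
  by exists m; rewrite /prefix subnn !divn1.
exists (ex_minn ex); case: ex_minnP => d du dmin.
have dm : d <= m by apply: dmin; rewrite /prefix subnn !divn1.
have d0 : 0 < d.
  by case: d du {dmin dm} => //; rewrite /prefix subn0 !divn_small // eqxx.
split; first by rewrite d0.
- by move=> h j hj; apply: dmin; apply: contra_neq hj => ->.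
- move=> j dj; under eq_finset => h do rewrite negbK.
  apply: card_collision; apply: contra_neq du => /(congr1 val).
  have lt v : v < 2 ^ m -> prefix j v < (2 ^ m).+1.
    by move=> vm; rewrite ltnS (leq_trans (leq_div _ _)) // ltnW.
  by rewrite /= !inordK ?lt // => eqj; rewrite !(prefix_coarsen _ dj) eqj.
have pre_half v : prefix d.-1 v = (prefix d v)./2.
  by rewrite (@prefix_coarsen d.-1 d) ?leq_pred // (_ : d - d.-1 = 1) ?divn2 //; lia.
have : prefix d.-1 u = prefix d.-1 w.
  by apply/eqP; apply/idPn => /dmin; lia.
have ltd : (prefix d u < prefix d w) = (u < w).
  apply/idP/idP => [|le]; first by rewrite !ltnNge; apply: contra => /leq_div2r ->.
  by rewrite ltn_neqAle du leq_div2r // ltnW.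
rewrite -ltd !pre_half; clear - du; move: du.
move: (prefix d u) (prefix d w) => x y xy half_xy.
have := odd_double_half x; have := odd_double_half y; rewrite half_xy; lia.
Qed.

Variables (fa : A -> nat) (fb : B -> nat).

Definition differ_test (h : hash_space) (j : nat) : proto A B bool :=
  hash_test (fun v => h (inord v)) (prefix j \o fa) (prefix j \o fb).

Definition step_proto (h : hash_space) (st : seq nat * nat) :
    proto A B (seq nat * nat) :=
  let: (s, hi) := st in
  let lo := head 0 s in
  let mid := (lo + hi)./2 in
  pbind (differ_test h lo) (fun q =>
    if q then PLeaf _ _ (behead s, lo)
    else if hi <= lo.+1 then PLeaf _ _ st
    else pbind (differ_test h mid) (fun q' =>
      PLeaf _ _ (if q' then (s, mid) else (mid :: s, hi)))).

Fixpoint run_proto k (r : rnd hash_space k) (st : seq nat * nat) :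
    proto A B (seq nat * nat) :=
  match k as k0 return rnd hash_space k0 -> proto A B (seq nat * nat) with
  | 0 => fun _ => PLeaf _ _ st
  | k'.+1 => fun r => pbind (step_proto r.1 st) (run_proto r.2)
  end r.

(** After a successful search the right end is the first difference, so one more bit from Alice
    settles the comparison. *)
Definition lt_proto k (r : rnd hash_space k) : proto A B bool :=
  pbind (run_proto r ([::], m)) (fun st =>
    PAlice (fun a => odd (prefix st.2 (fa a))) (PLeaf _ _ true) (PLeaf _ _ false)).

Lemma pdepth_lt_proto k (r : rnd hash_space k) : pdepth (lt_proto r) <= 10 * k + 1.
Proof.
apply: pdepth_bind => //; elim: k r ([::], m) => //= k IH r st.
(* Each round makes at most two hashed tests of 5 bits. *)
rewrite mulnS; apply: pdepth_bind => //; case: st => s hi.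
apply: (@pdepth_bind _ _ _ _ _ _ 5 5) => // -[] //.
case: ifP => // _; apply: (@pdepth_bind _ _ _ _ _ _ 5 0).
Qed.

Lemma peval_run_proto a b k (r : rnd hash_space k) st :
  peval a b (run_proto r st) = search_run (differ (fa a) (fb b)) r st.
Proof.
elim: k r st => //= k IH r [s hi]; rewrite peval_bind IH; congr search_run.
rewrite /step_proto peval_bind peval_hash_test /search_step -/(differ _ _ _ _).
case: ifP => // _; case: ifP => // _.
by rewrite peval_bind peval_hash_test -/(differ _ _ _ _) /=.
Qed.

Lemma lt_proto_error a b k : fa a < 2 ^ m -> fb b < 2 ^ m -> fa a != fb b ->
  2 ^ k * #|[set r : rnd hash_space k | peval a b (lt_proto r) != (fa a < fb b)]|
  <= m ^ 3 * #|rnd hash_space k|.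
Proof.
move=> am bm ab; have [d [/andP[d0 dm] sound err dE]] := first_difference am bm ab.
have inv : search_inv m d ([::], m) by rewrite /search_inv /= dm; lia.
apply: (@leq_trans (2 ^ k * #|[set r : rnd hash_space k |
    ~~ search_done d (search_run (differ (fa a) (fb b)) r ([::], m))]|)).
  rewrite leq_mul2l; apply/orP; right; apply/subset_leq_card/subsetP => r.
  rewrite !inE; apply: contra => don; rewrite /lt_proto peval_bind peval_run_proto /=.
  have := search_inv_run d0 sound r inv; move: don.
  case: search_run => s hi /andP[/= lod /eqP ->] /andP[_ /andP[/= dlo _]].
  (* A finished search has its left end below [d] and its right end, the successor, at least [d]. *)
  by rewrite (_ : (head 0 s).+1 = d); [rewrite -dE; case: odd|lia].
have /= := search_run_error d0 sound err k inv.
by move=> /leq_trans; apply; rewrite mulnC leq_mul2r leq_pred orbT.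
Qed.

End LessThan.

(** * Finding a false leaf of a sound binary tree *)

Section Trees.
Variable L : eqType.

Inductive tree := Leaf of L | Node of L & tree & tree.

Definition label t := match t with Leaf l | Node l _ _ => l end.

Fixpoint leaves t :=
  match t with Leaf l => [:: l] | Node _ t1 t2 => leaves t1 ++ leaves t2 end.

Fixpoint sound (sat : pred L) t :=
  match t with
  | Leaf _ => true
  | Node l t1 t2 =>
      [&& sound sat t1, sound sat t2 & sat (label t1) && sat (label t2) ==> sat l]
  end.

Lemma size_leaves_gt0 t : 0 < size (leaves t).
Proof. by elim: t => //= l t1 IH t2 _; rewrite size_cat addn_gt0 IH. Qed.

(* [t'] is [t] with the subtree [v] deleted and its sibling moved one step up:
   if the label of [v] holds, this keeps the tree sound. *)
Lemma tree_split k t : 0 < k < size (leaves t) -> exists v t',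
  [/\ size (leaves v) + size (leaves t') = size (leaves t),
      size (leaves v) <= k < 2 * size (leaves v),
      {subset leaves v <= leaves t}, {subset leaves t' <= leaves t} &
      forall sat, sound sat t -> sound sat v /\
        (sat (label v) ->
           sound sat t' /\ (sat (label t') -> sat (label t)))].
Proof.
elim: t => [l|l t1 IH1 t2 IH2] /= /andP[k0]; first by lia.
rewrite size_cat => kt.
(* Descend into the heavier child until at most [k] leaves remain: the parent has more than [k], so
   this child has more than [k / 2]. *)
case: (leqP (size (leaves t2)) (size (leaves t1))) => le.
- case: (leqP (size (leaves t1)) k) => kt1.
    exists t1, t2; split=> //; first by lia.
    + by move=> y yt; rewrite mem_cat yt.
    + by move=> y yt; rewrite mem_cat yt orbT.
    + move=> sat /and3P[s1 s2 /implyP imp]; split=> // v1; split=> // v2.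
      by apply: imp; rewrite v1.
  have [|v [t' [sz kv sv st H]]] := IH1; first by rewrite k0.
  exists v, (Node l t' t2); split=> //=.
  + by rewrite size_cat; lia.
  + by move=> y /sv yt; rewrite mem_cat yt.
  + by move=> y; rewrite !mem_cat => /orP[/st ->|->]; rewrite ?orbT.
  + move=> sat /and3P[/H[s1 H1] s2 /implyP imp]; split=> // /H1[s' imp'].
    rewrite s' s2; split=> //; apply/implyP => /andP[/imp' v1 v2].
    by apply: imp; rewrite v1.
- case: (leqP (size (leaves t2)) k) => kt2.
    exists t2, t1; split=> //; first by lia.
    + by lia.
    + by move=> y yt; rewrite mem_cat yt orbT.
    + by move=> y yt; rewrite mem_cat yt.
    + move=> sat /and3P[s1 s2 /implyP imp]; split=> // v2; split=> // v1.
      by apply: imp; rewrite v1.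
  have [|v [t' [sz kv sv st H]]] := IH2; first by rewrite k0.
  exists v, (Node l t1 t'); split=> //=.
  + by rewrite size_cat; lia.
  + by move=> y /sv yt; rewrite mem_cat yt orbT.
  + by move=> y; rewrite !mem_cat => /orP[->|/st ->]; rewrite ?orbT.
  + move=> sat /and3P[s1 /H[s2 H2] /implyP imp]; split=> // /H2[s' imp'].
    rewrite s' s1; split=> //; apply/implyP => /andP[v1 /imp' v2].
    by apply: imp; rewrite v1.
Qed.

Variables (A B X : Type) (fa : X -> A) (fb : X -> B) (sat : X -> pred L).
Variables (W : finType) (ev : L -> W -> proto A B bool) (c e : nat) (D : X -> Prop).
Hypothesis ev_depth : forall l w, pdepth (ev l w) <= c.
Hypothesis ev_error : forall x l, D x ->
  e * #|[set w | peval (fa x) (fb x) (ev l w) != sat x l]| <= #|W|.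

Definition finds_false_leaf t x l := (l \in leaves t) && ~~ sat x l.

(** Each round keeps at most two thirds of the leaves, so [k] rounds suffice; their errors add up to
    at most [k / e]. The predicate [D] allows evaluations that are reliable on some inputs only. *)
Lemma tree_search k t : size (leaves t) * 2 ^ k <= 3 ^ k ->
  exists P : rnd W k -> proto A B L,
    (forall r, pdepth (P r) <= k * c) /\
    forall x, D x -> sound (sat x) t -> ~~ sat x (label t) ->
      e * #|[set r | ~~ finds_false_leaf t x (peval (fa x) (fb x) (P r))]|
        <= k * #|rnd W k|.
Proof.
have single k' l : exists P : rnd W k' -> proto A B L,
    (forall r, pdepth (P r) <= k' * c) /\
    forall x, D x -> sound (sat x) (Leaf l) -> ~~ sat x l ->
      e * #|[set r | ~~ finds_false_leaf (Leaf l) x (peval (fa x) (fb x) (P r))]|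
        <= k' * #|rnd W k'|.
  exists (fun=> PLeaf _ _ l); split=> // x _ _ nl.
  rewrite (_ : [set r | _] = set0) ?cards0 ?muln0 //.
  by apply/setP => r; rewrite !inE /finds_false_leaf /= mem_head nl.
elim: k t => [|k IH] t.
  case: t => [l _|l t1 t2]; first exact: (single 0 l).
  rewrite /= size_cat.
  by have := size_leaves_gt0 t1; have := size_leaves_gt0 t2; lia.
move=> szt; case: (leqP (size (leaves t)) 1) => [t1|t2].
  case: t {szt} t1 => [l _|l t1 t2]; first exact: (single k.+1 l).
  rewrite /= size_cat.
  by have := size_leaves_gt0 t1; have := size_leaves_gt0 t2; lia.
(* With this threshold [v] has between one and two thirds of the leaves, hence so does [t']. *)
have [|v [t' [sz kv sv st H]]] := @tree_split ((2 * size (leaves t)) %/ 3) t.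
  by lia.
have szle s : 3 * s <= 2 * size (leaves t) -> s * 2 ^ k <= 3 ^ k.
  move: szt; rewrite !expnS; move: (2 ^ k) (3 ^ k) => a b le1 le2.
  have : 3 * s * a <= 2 * size (leaves t) * a by rewrite leq_mul2r le2 orbT.
  nia.
have [/szle szv /szle szt'] : 3 * size (leaves v) <= 2 * size (leaves t) /\
    3 * size (leaves t') <= 2 * size (leaves t).
  by clear -t2 sz kv; case/andP: kv; split; lia.
have [[Pv [Pv_depth Pv_err]] [Pt [Pt_depth Pt_err]]] := (IH v szv, IH t' szt').
exists (fun r => pbind (ev (label v) r.1) (fun o => if o then Pt r.2 else Pv r.2)).
split=> [r|x Dx snd ft].
  by rewrite mulSn; apply: pdepth_bind => // -[].
have [sndv snd'] := H _ snd.
set bad := [set r | _].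
pose bad_ev := [set w | peval (fa x) (fb x) (ev (label v) w) != sat x (label v)].
(* Unless the first evaluation errs, the continuation is fixed by the true value of [label v], so
   only its bad set counts. *)
suff [bad_rest [sub rest_err]] : exists S : {set rnd W k},
    (bad \subset setX bad_ev setT :|: setX setT S) /\ e * #|S| <= k * #|rnd W k|.
  have : #|bad| <= #|bad_ev| * #|rnd W k| + #|W| * #|bad_rest|.
    apply: leq_trans (subset_leq_card sub) _.
    by apply: leq_trans (leq_card_setU _ _) _; rewrite !cardsX !cardsT.
  have := ev_error (label v) Dx; rewrite -/bad_ev card_rndS => err le.
  have : e * #|bad_ev| * #|rnd W k| <= #|W| * #|rnd W k|.
    by rewrite leq_mul2r err orbT.
  have : #|W| * (e * #|bad_rest|) <= #|W| * (k * #|rnd W k|).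
    by rewrite leq_mul2l rest_err orbT.
  have : e * #|bad| <= e * (#|bad_ev| * #|rnd W k| + #|W| * #|bad_rest|).
    by rewrite leq_mul2l le orbT.
  rewrite mulSn; nia.
case: (boolP (sat x (label v))) => satv.
- have [sndt imp] := snd' satv.
  exists [set r | ~~ finds_false_leaf t' x (peval (fa x) (fb x) (Pt r))].
  split; last by apply: Pt_err => //; apply: contra ft.
  apply/subsetP => -[w r]; rewrite !inE /= andbT peval_bind satv eqb_id.
  case: (peval _ _ (ev _ _)) => //=; apply: contra.
  by rewrite /finds_false_leaf => /andP[/st -> ->].
- exists [set r | ~~ finds_false_leaf v x (peval (fa x) (fb x) (Pv r))].
  split; last exact: Pv_err.
  apply/subsetP => -[w r]; rewrite !inE /= andbT peval_bind (negbTE satv).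
  case: (peval _ _ (ev _ _)) => //=; apply: contra.
  by rewrite /finds_false_leaf => /andP[/sv -> ->].
Qed.

End Trees.

(** * Cutting planes proofs as trees, and the evaluation of their lines *)

Section CuttingPlanes.
Variable n : nat.
Implicit Types (l : ineq n) (x a b : assign n) (p : cp n).

(** Unary rules are contracted, so the root label may differ from the conclusion but still implies
    it. *)
Fixpoint cp_tree p : tree (ineq n) :=
  match p with
  | CPAx l => Leaf l
  | CPAdd q r => Node (cp_concl p) (cp_tree q) (cp_tree r)
  | CPMul _ q | CPDiv _ q => cp_tree q
  end.

Lemma size_leaves_cp_tree p : size (leaves (cp_tree p)) <= cp_size p.
Proof. by elim: p => //= [p IHp q IHq|_ p|_ p]; rewrite ?size_cat; lia. Qed.

Lemma leaves_cp_tree I p : cp_valid I p -> {subset leaves (cp_tree p) <= I}.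
Proof.
elim: p => /= [l lI y|p IHp q IHq /andP[/IHp sp /IHq sq] y|d p IH /andP[_ /IH] //|d p IH].
- by rewrite inE => /eqP ->.
- by rewrite mem_cat => /orP[/sp|/sq].
- by case/and3P=> _ _ /IH.
Qed.

Local Open Scope ring_scope.

Lemma satisfies_add l1 l2 x : satisfies x l1 -> satisfies x l2 ->
  satisfies x ([ffun i => l1.1 i + l2.1 i], l1.2 + l2.2).
Proof.
rewrite /satisfies /lhs_val /= => h1 h2.
under eq_bigr do rewrite ffunE mulrDl.
by rewrite big_split lerD.
Qed.

Lemma satisfies_mul d l x : 0 < d -> satisfies x l ->
  satisfies x ([ffun i => d * l.1 i], d * l.2).
Proof.
rewrite /satisfies /lhs_val /= => d0 h.
under eq_bigr do rewrite ffunE -mulrA.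
by rewrite -mulr_sumr ler_pM2l.
Qed.

Lemma satisfies_div c l x : 0 < c -> [forall i, (c %| l.1 i)%Z] ->
  satisfies x l -> satisfies x ([ffun i => (l.1 i %/ c)%Z], (l.2 %/ c)%Z).
Proof.
rewrite /satisfies /lhs_val /= => c0 /forallP dv h.
(* Rounding is harmless because the divided left-hand side is an integer. *)
rewrite lez_divRL // mulr_suml.
apply: le_trans h; rewrite le_eqVlt; apply/orP; left; apply/eqP.
by apply: eq_bigr => i _; rewrite ffunE mulrAC divzK.
Qed.

Lemma sound_cp_tree I p x : cp_valid I p ->
  sound (satisfies x) (cp_tree p) /\
  (satisfies x (label (cp_tree p)) -> satisfies x (cp_concl p)).
Proof.
elim: p => //= [p IHp q IHq /andP[/IHp[sp ip] /IHq[sq iq]]|d p IH|c p IH].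
- split=> //; rewrite sp sq /=; apply/implyP => /andP[/ip hp /iq hq].
  exact: satisfies_add.
- by case/andP=> d0 /IH[sp ip]; split=> // /ip; exact: satisfies_mul.
- by case/and3P=> c0 dv /IH[sp ip]; split=> // /ip; exact: satisfies_div.
Qed.

Lemma arith_false_unsatisfied l x : arith_false l -> ~~ satisfies x l.
Proof.
case/andP=> /forallP l0 neg; rewrite /satisfies -ltNge /lhs_val big1 // => i _.
by rewrite (eqP (l0 i)) mul0r.
Qed.

Lemma lhs_val_restr l x (S : {set 'I_n}) :
  lhs_val l x = lhs_val l (restr S x) + lhs_val l (restr (~: S) x).
Proof.
rewrite /lhs_val -big_split; apply: eq_bigr => i _ /=.
by rewrite !ffunE inE; case: (i \in S); rewrite /= mulr0 ?addr0 ?add0r.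
Qed.

(* Comparing the two halves of a line only depends on their order among the at
   most 2 ^ n values of Alice's half, so ranks replace the unbounded
   coefficients.  Making Alice's rank odd and Bob's even rules out equality. *)
Definition alice_rank l a : nat :=
  (#|[set a' : assign n | (lhs_val l a' < lhs_val l a)%R]|.*2.+1)%N.

Definition bob_rank l b : nat :=
  (#|[set a' : assign n | (lhs_val l a' <= l.2 - lhs_val l b)%R]|.*2)%N.

(** If the line holds, [a] belongs to Bob's set but not to Alice's, making the inclusion proper;
    otherwise the inclusion is reversed. *)
Lemma rank_lt l a b :
  (alice_rank l a < bob_rank l b)%N = (lhs_val l a + lhs_val l b <= l.2).
Proof.
rewrite /alice_rank /bob_rank ltn_Sdouble -lerBrDr.
case: leP => le.
- apply/proper_card/properP; split.
    by apply/subsetP => a'; rewrite !inE => /ltW /le_trans; apply.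
  by exists a; rewrite !inE ?ltxx.
- apply/negbTE; rewrite -leqNgt; apply/subset_leq_card/subsetP => a'.
  by rewrite !inE => /le_lt_trans; apply.
Qed.

Lemma alice_rank_neq l a b : alice_rank l a != bob_rank l b.
Proof. by apply/eqP => /(congr1 odd); rewrite /= !odd_double. Qed.

Lemma card_assign : #|{: assign n}| = (2 ^ n)%N.
Proof. by rewrite card_ffun card_bool card_ord. Qed.

Lemma alice_rank_lt l a : (alice_rank l a < 2 ^ n.+2)%N.
Proof.
have := max_card [set a' : assign n | (lhs_val l a' < lhs_val l a)%R].
rewrite card_assign /alice_rank !expnS; have := expn_gt0 2 n; lia.
Qed.

Lemma bob_rank_lt l b : (bob_rank l b < 2 ^ n.+2)%N.
Proof.
have := max_card [set a' : assign n | (lhs_val l a' <= l.2 - lhs_val l b)%R].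
rewrite card_assign /bob_rank !expnS; have := expn_gt0 2 n; lia.
Qed.

Local Close Scope ring_scope.

(** * Upper bounds for the Karchmer-Wigderson game *)

Variables (I : seq (ineq n)) (S : {set 'I_n}).

Lemma kw_protocol (W : finType) c e (D : assign n -> Prop)
    (ev : ineq n -> W -> proto (assign n) (assign n) bool) p k :
  cp_refutation I p -> cp_size p * 2 ^ k <= 3 ^ k ->
  (forall l w, pdepth (ev l w) <= c) ->
  (forall x l, D x -> e * #|[set w |
     peval (restr S x) (restr (~: S) x) (ev l w) != satisfies x l]| <= #|W|) ->
  exists P : rnd W k -> proto (assign n) (assign n) (ineq n),
    (forall r, pdepth (P r) <= k * c) /\
    forall x, D x ->
      e * #|[set r | ~~ kw_correct I x (kw_run S (P r) x)]| <= k * #|rnd W k|.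
Proof.
move=> /andP[val false] sz dep err.
have [|P [Pd Pe]] := @tree_search _ _ _ _ _ _ _ _ _ _ _ _ dep err k (cp_tree p).
  by apply: leq_trans sz; rewrite leq_mul2r size_leaves_cp_tree orbT.
exists P; split=> // x Dx.
have [snd concl] := sound_cp_tree x val.
have nf : ~~ satisfies x (label (cp_tree p)).
  by apply: contra (arith_false_unsatisfied x false).
apply: leq_trans (Pe x Dx snd nf); rewrite leq_mul2l; apply/orP; right.
apply/subset_leq_card/subsetP => r; rewrite !inE; apply: contra.
by case/andP=> /(leaves_cp_tree val) lI nl; rewrite /kw_correct lI nl.
Qed.

Lemma line_error x l k (q := 2 ^ k %/ n.+2 ^ 3) :
  q * #|[set r : rnd (hash_space n.+2) k |
    peval (restr S x) (restr (~: S) x)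
      (lt_proto (alice_rank l) (bob_rank l) r) != satisfies x l]|
  <= #|rnd (hash_space n.+2) k|.
Proof.
have := lt_proto_error k (alice_rank_lt l (restr S x))
  (bob_rank_lt l (restr (~: S) x)) (alice_rank_neq l _ _).
rewrite rank_lt -lhs_val_restr -/(satisfies x l); set y := #|_| => le.
have n3 : 0 < n.+2 ^ 3 by rewrite expn_gt0.
rewrite -(leq_pmul2l n3); apply: leq_trans le.
by rewrite mulnA leq_mul2r mulnC leq_divM orbT.
Qed.

Lemma kw_upper_bound_hashing t p k j :
  kw_requires I S t -> cp_refutation I p -> cp_size p * 2 ^ k <= 3 ^ k ->
  3 * k.+1 * n.+2 ^ 3 <= 2 ^ j -> t <= k * (10 * j + 1).
Proof.
move=> req ref sz large.
pose ev l r := lt_proto (alice_rank l) (bob_rank l) (r : rnd (hash_space n.+2) j).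
have W0 : 0 < #|rnd (rnd (hash_space n.+2) j) k|.
  by do 2!apply: card_rnd_gt0; apply/card_gt0P; exists [ffun=> ord0].
(* Error [1 / (3 * (k + 1))] per line keeps the total over [k] rounds below 1/3. *)
have [||P [Pd Pe]] := @kw_protocol (rnd (hash_space n.+2) j) (10 * j + 1)
  (3 * k.+1) (fun=> True) ev p k ref sz.
- by move=> l w; exact: pdepth_lt_proto.
- move=> x l _; apply: leq_trans (line_error x l j); rewrite leq_mul2r.
  by rewrite leq_divRL ?expn_gt0 // large orbT.
have [|r tr] := req _ P W0; last by apply: leq_trans tr (Pd r).
move=> x; have := Pe x Logic.I; move: #|[set _ | _]| #|rnd _ k| => y z le.
rewrite -(leq_pmul2l (ltn0Sn k)); nia.
Qed.

Lemma kw_upper_bound_trivial t p k :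
  kw_requires I S t -> cp_refutation I p -> cp_size p * 2 ^ k <= 3 ^ k ->
  t <= n + k.
Proof.
move=> req ref sz.
(* Once Alice's half [a] is known, Bob evaluates any line with one bit and no error. As [rnd unit k]
   is a singleton, the factor [k.+1] forces the bad set to be empty. *)
have /fin_all_exists[P PP] (a : assign n) :
  exists P : rnd unit k -> proto (assign n) (assign n) (ineq n),
    (forall r, pdepth (P r) <= k * 1) /\
    forall x, restr S x = a -> k.+1 *
      #|[set r | ~~ kw_correct I x (kw_run S (P r) x)]| <= k * #|rnd unit k|.
  pose ev l (_ : unit) : proto (assign n) (assign n) bool :=
    PBob (fun b => (lhs_val l a + lhs_val l b <= l.2)%R)
      (PLeaf _ _ false) (PLeaf _ _ true).
  apply: (@kw_protocol unit 1 k.+1 (fun x => restr S x = a) ev p) => // x l xa.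
  rewrite (_ : [set w | _] = set0) ?cards0 ?muln0 //.
  apply/setP => w; rewrite !inE /= /satisfies (lhs_val_restr l x S) xa.
  by case: ifP.
pose Q r : proto (assign n) (assign n) (ineq n) :=
  pbind (psend _ n (fun a : assign n => enum_rank a))
    (fun v => P (nth [ffun=> false] (enum {: assign n}) v) r).
have [||r tr] := req _ Q; first by apply: card_rnd_gt0; rewrite card_unit.
- move=> x; have [_ /(_ x erefl)] := PP (restr S x).
  have -> : [set r | ~~ kw_correct I x (kw_run S (Q r) x)] =
            [set r | ~~ kw_correct I x (kw_run S (P (restr S x) r) x)].
    apply/setP => r; rewrite !inE /kw_run /Q peval_bind peval_send ?nth_enum_rank //.
    by rewrite -card_assign ltn_ord.
  have -> : #|rnd unit k| = 1.
    by elim: (k) => [|k' IH]; rewrite ?card_rndS ?IH card_unit.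
  by case: #|_| => // y; nia.
apply: leq_trans tr _; apply: pdepth_bind; first exact: pdepth_send.
move=> v; have [+ _] := PP (nth [ffun=> false] (enum {: assign n}) v).
by move=> /(_ r); rewrite muln1.
Qed.

Lemma kw_upper_bound t p : 2 <= n ->
  kw_requires I S t -> cp_refutation I p ->
  t <= 222 * (up_log 2 (cp_size p) * up_log 2 n).
Proof.
move=> n2 req ref; set u := up_log 2 (cp_size p); set v := up_log 2 n.
have v0 : 0 < v by rewrite up_log_gt0.
have su : cp_size p <= 2 ^ u by apply: up_logP.
have nv : n <= 2 ^ v by apply: up_logP.
(* Two rounds shrink the tree by [9 / 4], more than 2, so [2 * u] rounds suffice. *)
have sz : cp_size p * 2 ^ u.*2 <= 3 ^ u.*2.
  apply: (@leq_trans (8 ^ u)); last first.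
    by rewrite -mul2n expnM; case: (u) => // u'; rewrite leq_exp2r.
  by rewrite -[8]/(2 * 4) expnMn -mul2n expnM leq_mul2r su orbT.
case: (leqP u n) => un.
(* The choice of [j] comes from [72 * n ^ 4 <= 2 ^ 7 * n ^ 4]; then [2 * u * (40 * v + 71)] is at
   most [222 * u * v]. *)
- have := @kw_upper_bound_hashing t p u.*2 (4 * v + 7) req ref sz.
  have large : 3 * u.*2.+1 * n.+2 ^ 3 <= 2 ^ (4 * v + 7).
    apply: (@leq_trans (3 * (3 * n) * (2 * n) ^ 3)).
      by apply: leq_mul; [lia|rewrite leq_exp2r //; lia].
    apply: (@leq_trans (2 ^ 7 * n ^ 4)); first by rewrite !expnS expn0; nia.
    by rewrite addnC expnD leq_mul2l mulnC expnM leq_exp2r // nv orbT.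
  move=> /(_ large); nia.
- have := kw_upper_bound_trivial req ref sz; nia.
Qed.

End CuttingPlanes.

(** * From rounded binary logarithms to real logarithms *)

Lemma pow2_up_log_le s : 0 < s -> 2 ^ up_log 2 s <= s ^ 2.
Proof.
move=> s0; case: (ltnP 1 s) => [s1|]; last by case: s s0 => [|[|]].
have /andP[lt _] := @up_log_bounds 2 s isT s1.
have u0 : 0 < up_log 2 s by rewrite up_log_gt0.
rewrite -(prednK u0) expnS -[s ^ 2]/(s * s); nia.
Qed.

From Stdlib Require Import Reals Lra.

Lemma INR_expn b k : INR (expn b k) = (INR b ^ k)%R.
Proof. by elim: k => // k IH; rewrite expnS mult_INR IH. Qed.

Lemma up_log_le_ln s : (0 < s)%N ->
  (INR (up_log 2 s) * ln 2 <= 2 * ln (INR s))%R.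
Proof.
move=> s0; have s0R : (0 < INR s)%R by apply/lt_0_INR/ssrnat.ltP.
have := pow2_up_log_le s0 => /ssrnat.leP/le_INR; rewrite !INR_expn.
have -> : INR 2 = 2%R by [].
move=> le; have : (ln (2 ^ up_log 2 s) <= ln (INR s ^ 2))%R.
  case: le => [lt|->]; last exact: Rle_refl.
  by apply/Rlt_le/ln_increasing => //; apply: pow_lt; lra.
by rewrite !ln_pow //; lra.
Qed.

Theorem theorem1 :
  exists c : R, (0 < c)%R /\
    forall (n : nat) (I : seq (ineq n)) (S : {set 'I_n}) (t : nat),
      (2 <= n)%N ->
      unsat01 I ->
      S != set0 -> S != setT ->
      kw_requires I S t ->
      forall p : cp n, cp_refutation I p ->
        (Rpower 2 (c * INR t / ln (INR n)) <= INR (cp_size p))%R.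
Proof.
have ln2 : (0 < ln 2)%R by have := ln_lt_2; lra.
(* Here [888 = 222 * 2 * 2], each 2 coming from rounding one logarithm up; the factor [ln 2]
   accounts for the natural logarithm in the exponent. *)
exists (ln 2 / 888)%R; split; first by lra.
move=> n I S t n2 _ _ _ req p ref.
have s0 : (0 < cp_size p)%N by case: (p).
have n0 : (0 < n)%N by apply: leq_trans n2.
have lnn : (0 < ln (INR n))%R.
  by rewrite -ln_1; apply: ln_increasing; [lra|apply: (lt_INR 1); apply/ssrnat.ltP].
have sR : (0 < INR (cp_size p))%R by apply/lt_0_INR/ssrnat.ltP.
rewrite /Rpower -[X in (_ <= X)%R](exp_ln _ sR).
have /ssrnat.leP/le_INR := kw_upper_bound n2 req ref.
rewrite !mult_INR (INR_IZR_INZ 222) [IZR _]/=.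
have := up_log_le_ln s0; have := up_log_le_ln n0.
have := pos_INR (up_log 2 n); have := pos_INR (up_log 2 (cp_size p)).
move: (ln (INR (cp_size p))) (ln (INR n)) lnn (ln 2) ln2 (INR (up_log 2 (cp_size p)))
  (INR (up_log 2 n)) (INR t) => ls lm lm0 l2 l20 u v t' u0 v0 le_v le_u le_t.
have le : (t' * (l2 * l2) <= 888 * (ls * lm))%R.
  have : ((u * l2) * (v * l2) <= (2 * ls) * (2 * lm))%R.
    by apply: Rmult_le_compat => //; apply: Rmult_le_pos => //; lra.
  have : (t' * (l2 * l2) <= 222 * (u * v) * (l2 * l2))%R.
    by apply: Rmult_le_compat_r => //; nra.
  lra.
have le_ls : (l2 / 888 * t' / lm * l2 <= ls)%R.
  apply: (Rmult_le_reg_r lm) => //.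
  have -> : (l2 / 888 * t' / lm * l2 * lm = t' * (l2 * l2) / 888)%R.
    by field; lra.
  lra.
case: le_ls => [lt|->]; last exact: Rle_refl.
by apply/Rlt_le/exp_increasing.
Qed.
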